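(* For every integer $k\ge1$, the algebra $T_{3,2,k}=\mathbb{C}[x_1,x_2,x_3]/(x_1^2,x_2^2,x_3^2)^k$ has the weak Lefschetz property.
   Context: A standard graded algebra $A=\bigoplus_i A_i$ over $\mathbb{C}$ has the weak Lefschetz property (WLP) if there exists a linear form $L\in A_1$ such that for every degree $i$ the multiplication map $\times L\colon A_i\to A_{i+1}$ has maximal rank, i.e. is injective or surjective. Here $(x_1^2,x_2^2,x_3^2)^k$ is the $k$-th power of the ideal generated by $x_1^2,x_2^2,x_3^2$. *)

(* Defs.v *)
From HB Require Import structures.
From mathcomp Require Import all_boot all_order all_algebra ring_quotient.
From mathcomp Require Import boolp mpoly.

Set Implicit Arguments.
Unset Strict Implicit.
Unset Printing Implicit Defensive.

Import GRing.Theory.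
Local Open Scope ring_scope.
Local Open Scope quotient_scope.

Section StandardGraded.
Variables (F : fieldType) (A : comAlgType F) (gr : nat -> A -> Prop).

(* [gr i] is the homogeneous component of degree [i]. The last clause is
   standardness: finitely many elements of degree 1 generate the algebra. *)
Record standard_grading : Prop := StandardGrading {
  gr0 : forall i, gr i 0;
  grP : forall i (c : F) x y, gr i x -> gr i y -> gr i (c *: x + y);
  grM : forall i j x y, gr i x -> gr j y -> gr (i + j)%N (x * y);
  gr_scalar : forall x, gr 0%N x <-> exists c : F, x = c%:A;
  gr_sum : forall x, exists m (f : nat -> A),
    (forall i, gr i (f i)) /\ x = \sum_(i < m) f i;
  gr_direct : forall m (f : nat -> A), (forall i, gr i (f i)) ->
    \sum_(i < m) f i = 0 -> forall i, (i < m)%N -> f i = 0;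
  gr_gen1 : exists m (g : 'I_m -> A), (forall j, gr 1%N (g j)) /\
    forall x, exists p : {mpoly F[m]}, x = mmap (in_alg A) g p }.

End StandardGraded.

Record stdGradedAlg (F : fieldType) := StdGradedAlg {
  sga_alg :> comAlgType F;
  sga_deg : nat -> sga_alg -> Prop;
  sga_std : standard_grading sga_deg }.

Arguments sga_deg {F} A i x : rename.

Definition WLP (F : fieldType) (A : stdGradedAlg F) : Prop :=
  exists L : A, sga_deg A 1%N L /\
    forall i : nat,
      (forall x y : A, sga_deg A i x -> sga_deg A i y ->
         L * x = L * y -> x = y) \/
      (forall y : A, sga_deg A i.+1 y ->
         exists x : A, sga_deg A i x /\ L * x = y).

Section Ideals.
Variable R : comNzRingType.
Implicit Types (S I J : R -> Prop) (p : R).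

Definition ideal_gen S p : Prop :=
  exists s : seq (R * R),
    (forall x, x \in s -> S x.2) /\ p = \sum_(x <- s) x.1 * x.2.

Definition ideal_mul I J : R -> Prop :=
  ideal_gen (fun p => exists a b, [/\ I a, J b & p = a * b]).

(* I^0 is the whole ring and I^(k+1) = I * I^k, as ideals. *)
Fixpoint ideal_exp I (k : nat) : R -> Prop :=
  if k is k'.+1 then ideal_mul I (ideal_exp I k') else fun=> True.

Lemma ideal_gen0 S : ideal_gen S 0.
Proof. by exists [::]; split=> //; rewrite big_nil. Qed.

Lemma ideal_genD S u v : ideal_gen S u -> ideal_gen S v -> ideal_gen S (u + v).
Proof.
move=> [s [hs ->]] [t [ht ->]]; exists (s ++ t); rewrite big_cat; split=> // x.
by rewrite mem_cat => /orP[/hs|/ht].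
Qed.

Lemma ideal_genM S a u : ideal_gen S u -> ideal_gen S (a * u).
Proof.
move=> [s [hs ->]]; exists [seq (a * x.1, x.2) | x <- s]; split.
  by move=> x /mapP[y ys ->]; exact: hs ys.
by rewrite big_map mulr_sumr; apply: eq_bigr => x _; rewrite mulrA.
Qed.

Lemma ideal_gen_in S g : S g -> ideal_gen S g.
Proof.
move=> Sg; exists [:: (1, g)]; split; last by rewrite big_seq1 mul1r.
by move=> x; rewrite inE => /eqP->.
Qed.

Lemma ideal_gen_bigsum S (T : Type) (r : seq T) (P : pred T) (f : T -> R) :
  (forall i, P i -> ideal_gen S (f i)) -> ideal_gen S (\sum_(i <- r | P i) f i).
Proof.
move=> h; apply: (big_ind (ideal_gen S)) => //.
- exact: ideal_gen0.
- exact: ideal_genD.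
Qed.

Lemma ideal_gen_min S I : I 0 -> (forall a u v, I u -> I v -> I (a * u + v)) ->
  (forall g, S g -> I g) -> forall p, ideal_gen S p -> I p.
Proof.
move=> I0 IP SI p [s [hs ->]]; elim: s hs => [|x s IHs] hs; first by rewrite big_nil.
rewrite big_cons; apply: IP; first by apply/SI/hs; rewrite mem_head.
by apply: IHs => y ys; apply: hs; rewrite inE ys orbT.
Qed.

Lemma ideal_mul_subl I J : I 0 -> (forall a u v, I u -> I v -> I (a * u + v)) ->
  forall p, ideal_mul I J p -> I p.
Proof.
move=> I0 IP; apply: ideal_gen_min => // _ [a [b [Ia _ ->]]].
by rewrite mulrC -[b * a]addr0; apply: IP.
Qed.

End Ideals.

Section Homogeneous.
Variables (F : fieldType) (n : nat).
Implicit Types (S I J : {mpoly F[n]} -> Prop) (p q : {mpoly F[n]}).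

Definition homogeneous I := forall p d, I p -> I (pihomog mdeg d p).

Lemma pihomogM p q d :
  pihomog mdeg d (p * q) =
  \sum_(i < msize p) \sum_(j < msize q)
     if (i + j == d)%N then pihomog mdeg i p * pihomog mdeg j q else 0.
Proof.
rewrite {1}(@pihomog_partitionE _ _ mdeg (msize p) p) ?leqnn //.
rewrite {1}(@pihomog_partitionE _ _ mdeg (msize q) q) ?leqnn //.
rewrite mulr_suml raddf_sum; apply: eq_bigr => i _ /=.
rewrite mulr_sumr raddf_sum; apply: eq_bigr => j _ /=.
have h : pihomog mdeg i p * pihomog mdeg j q \is (i + j).-homog.
  by apply: dhomogM; apply: pihomogP.
case: eqP => [<-|/eqP ne]; first exact: pihomog_dE h.
exact: pihomog_ne0 ne h.
Qed.

Lemma homogeneous_gen S :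
  (forall p d, S p -> ideal_gen S (pihomog mdeg d p)) ->
  homogeneous (ideal_gen S).
Proof.
move=> hS p d [s [hs ->]]; rewrite big_seq raddf_sum.
apply: ideal_gen_bigsum => x xs /=; rewrite pihomogM.
apply: ideal_gen_bigsum => i _; apply: ideal_gen_bigsum => j _.
by case: ifP => _; [apply/ideal_genM/hS/hs | apply: ideal_gen0].
Qed.

Lemma homogeneous_mul I J :
  homogeneous I -> homogeneous J -> homogeneous (ideal_mul I J).
Proof.
move=> hI hJ; apply: homogeneous_gen => _ d [a [b [Ia Jb ->]]].
rewrite pihomogM; apply: ideal_gen_bigsum => i _; apply: ideal_gen_bigsum => j _.
case: ifP => _; last exact: ideal_gen0.
apply: ideal_gen_in; exists (pihomog mdeg i a), (pihomog mdeg j b).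
by split=> //; [apply: hI | apply: hJ].
Qed.

Lemma homogeneous_exp I k : homogeneous I -> homogeneous (ideal_exp I k).
Proof. by move=> hI; elim: k => // k; apply: homogeneous_mul. Qed.

End Homogeneous.

(* Proper homogeneous ideals: [hi_1] is what makes the quotient a ring with
   1 != 0, [hi_homog] what makes its grading well defined. *)
Record homogIdeal (F : fieldType) (n : nat) := HomogIdeal {
  hi_mem :> {mpoly F[n]} -> Prop;
  hi_0 : hi_mem 0;
  hi_1 : ~ hi_mem 1;
  hi_P : forall a u v, hi_mem u -> hi_mem v -> hi_mem (a * u + v);
  hi_homog : homogeneous hi_mem }.

Section Quotient.
Variables (F : fieldType) (n : nat) (I : homogIdeal F n).

(* [{ideal_quot _}] wants a boolean membership predicate, hence [asbool]. *)
Definition hi_pred : {pred {mpoly F[n]}} := fun p => `[< I p >].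

Lemma hi_predP p : reflect (I p) (p \in hi_pred).
Proof. exact: asboolP. Qed.

Lemma hi_pred_closed : idealr_closed hi_pred.
Proof.
split; first by apply/hi_predP/hi_0.
  by apply/hi_predP/hi_1.
by move=> a u v /hi_predP Iu /hi_predP Iv; apply/hi_predP/hi_P.
Qed.

HB.instance Definition _ := isIdealr.Build _ hi_pred hi_pred_closed.

Definition hquot := {ideal_quot hi_pred}.

HB.instance Definition _ := GRing.ComNzRing.on hquot.
HB.instance Definition _ := EqQuotient.on hquot.

Definition hpi (p : {mpoly F[n]}) : hquot := \pi_(hquot) p.

Lemma hpiD p q : hpi (p + q) = hpi p + hpi q.
Proof. exact: (@rmorphD _ _ (\pi_({ideal_quot hi_pred}))). Qed.

Lemma hpiM p q : hpi (p * q) = hpi p * hpi q.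
Proof. exact: (@rmorphM _ _ (\pi_({ideal_quot hi_pred}))). Qed.

Lemma hpi0 : hpi 0 = 0.
Proof. exact: (@rmorph0 _ _ (\pi_({ideal_quot hi_pred}))). Qed.

Lemma hpi1 : hpi 1 = 1.
Proof. exact: (@rmorph1 _ _ (\pi_({ideal_quot hi_pred}))). Qed.

Lemma hpiK x : exists p, x = hpi p.
Proof. by exists (repr (x : {ideal_quot hi_pred})); rewrite /hpi reprK. Qed.

Lemma hpi_eq0 p : hpi p = 0 <-> I p.
Proof.
rewrite -hpi0 /hpi; split=> [/eqP|Ip].
  by rewrite -Quotient.idealrBE subr0 => /hi_predP.
by apply/eqP; rewrite -Quotient.idealrBE subr0; apply/hi_predP.
Qed.

Definition hscale (c : F) (x : hquot) : hquot := hpi c%:MP * x.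

Lemma hscaleA c d x : hscale c (hscale d x) = hscale (c * d) x.
Proof. by rewrite /hscale mulrA -hpiM mpolyCM. Qed.

Lemma hscale1 : left_id 1 hscale.
Proof. by move=> x; rewrite /hscale mpolyC1 hpi1 mul1r. Qed.

Lemma hscaleDr : right_distributive hscale +%R.
Proof. by move=> c x y; rewrite /hscale mulrDr. Qed.

Lemma hscaleDl x : {morph hscale^~ x : c d / c + d}.
Proof. by move=> c d; rewrite /hscale mpolyCD hpiD mulrDl. Qed.

HB.instance Definition _ :=
  GRing.Zmodule_isLmodule.Build F hquot hscaleA hscale1 hscaleDr hscaleDl.

Lemma hscaleAl (c : F) (x y : hquot) : c *: (x * y) = (c *: x) * y.
Proof. exact: mulrA. Qed.

HB.instance Definition _ := GRing.Lmodule_isLalgebra.Build F hquot hscaleAl.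
HB.instance Definition _ := GRing.Lalgebra_isComAlgebra.Build F hquot.

Definition hquot_deg (i : nat) (x : hquot) : Prop :=
  exists p : {mpoly F[n]}, p \is i.-homog /\ x = hpi p.

Lemma hpiZ c p : hpi (c *: p) = c *: hpi p.
Proof. by rewrite -mul_mpolyC hpiM. Qed.

Lemma hpi_sum (T : Type) (r : seq T) (P : pred T) (f : T -> {mpoly F[n]}) :
  hpi (\sum_(i <- r | P i) f i) = \sum_(i <- r | P i) hpi (f i).
Proof. exact: (big_morph hpi hpiD hpi0). Qed.

Lemma hpi_mmap p : hpi p = mmap (in_alg hquot) (fun i : 'I_n => hpi 'X_i) p.
Proof.
rewrite {1}[p]mpolyE hpi_sum /mmap; apply: eq_bigr => m _.
rewrite hpiZ /= mulr_algl; congr (_ *: _).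
rewrite mpolyXE_id (big_morph hpi hpiM hpi1) /mmap1.
apply: eq_bigr => i _; elim: (m i) => [|k IHk]; first by rewrite !expr0 hpi1.
by rewrite !exprS hpiM IHk.
Qed.

Lemma hquot_std : standard_grading hquot_deg.
Proof.
split.
- by move=> i; exists 0; rewrite hpi0; split=> //; apply: dhomog0.
- move=> i c x y [p [hp ->]] [q [hq ->]]; exists (c *: p + q).
  by rewrite hpiD hpiZ; split=> //; apply: rpredD => //; apply: rpredZ.
- move=> i j x y [p [hp ->]] [q [hq ->]]; exists (p * q).
  by rewrite hpiM; split=> //; apply: dhomogM.
- move=> x; split=> [[p [hp ->]]|[c ->]].
    exists p@_0; rewrite -hpi1 -hpiZ; congr hpi; apply/mpolyP=> m.
    rewrite mcoeffZ mcoeff1; case: eqP => [->|/eqP nz]; first by rewrite mulr1.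
    by rewrite mulr0; apply: dhomog_nemf_coeff hp _; rewrite mdeg_eq0.
  exists (c *: 1); rewrite hpiZ hpi1; split=> //.
  by apply: rpredZ; apply: dhomog1.
- move=> x; have [p ->] := hpiK x.
  exists (msize p), (fun i => hpi (pihomog mdeg i p)); split.
    by move=> i; exists (pihomog mdeg i p); split=> //; apply: pihomogP.
  by rewrite -hpi_sum -pihomog_partitionE.
- move=> m f /choice[g hg] hsum i lt_im.
  have Ig : I (\sum_(j < m) g j).
    apply/hpi_eq0; rewrite hpi_sum -[RHS]hsum.
    by apply: eq_bigr => j _; case: (hg j).
  rewrite (hg i).2; apply/hpi_eq0; have := hi_homog i Ig.
  rewrite raddf_sum (bigD1 (Ordinal lt_im)) //= big1 ?addr0.
    by rewrite pihomog_dE //; case: (hg i).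
  move=> j ne; apply: (pihomog_ne0 _ (hg j).1).
  by apply: contraNneq ne => e; apply/eqP/val_inj.
- exists n, (fun i => hpi 'X_i); split=> [j|x].
    by exists 'X_j; split=> //; rewrite dhomogX; apply/eqP; exact: mdeg1.
  by have [p ->] := hpiK x; exists p; apply: hpi_mmap.
Qed.

Definition graded_quotient : stdGradedAlg F := StdGradedAlg hquot_std.

End Quotient.

Section PowerAlgebra.
Variables (F : fieldType) (n d k : nat).

Definition pow_ideal : {mpoly F[n]} -> Prop :=
  ideal_exp (ideal_gen (fun g => exists i : 'I_n, g = 'X_i ^+ d)) k.

Hypotheses (d_gt0 : (0 < d)%N) (k_gt0 : (0 < k)%N).

Lemma pow_ideal_0 : pow_ideal 0.
Proof. by rewrite /pow_ideal; case: k => // k'; apply: ideal_gen0. Qed.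

Lemma pow_ideal_P a u v : pow_ideal u -> pow_ideal v -> pow_ideal (a * u + v).
Proof.
rewrite /pow_ideal; case: k => // k' hu hv.
by apply: ideal_genD => //; apply: ideal_genM.
Qed.

Lemma pow_ideal_1 : ~ pow_ideal 1.
Proof.
rewrite /pow_ideal; case: k k_gt0 => // k' _ h1.
have {h1} := ideal_mul_subl (ideal_gen0 _)
  (fun a u v hu => ideal_genD (ideal_genM a hu)) h1.
move=> /(@ideal_gen_min _ _ (fun p : {mpoly F[n]} => p@_0 = 0)) h1.
suff /eqP : (1 : {mpoly F[n]})@_0 = 0 by rewrite mcoeff1 eqxx oner_eq0.
apply: h1.
- exact: mcoeff0.
- by move=> a u v hu hv; rewrite mcoeffD rmorphM /= hu hv mulr0 addr0.
- move=> _ [i ->]; rewrite mpolyXn mcoeffX.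
  case: eqP => // /(congr1 mdeg); rewrite mdegMn mdeg1 mdeg0 mul1n.
  by move=> d0; move: d_gt0; rewrite d0.
Qed.

Lemma pow_ideal_homog : homogeneous pow_ideal.
Proof.
apply: homogeneous_exp; apply: homogeneous_gen => _ e [i ->].
rewrite mpolyXn pihomogX; case: ifP => _; last exact: ideal_gen0.
by apply: ideal_gen_in; exists i; rewrite mpolyXn.
Qed.

Definition pow_homogIdeal : homogIdeal F n :=
  HomogIdeal pow_ideal_0 pow_ideal_1 pow_ideal_P pow_ideal_homog.

(* F[x_1, ..., x_n] / (x_1^d, ..., x_n^d)^k; positivity of d and k makes the
   ideal proper, as required of quotient rings here. *)
Definition powAlg : stdGradedAlg F := graded_quotient pow_homogIdeal.

End PowerAlgebra.

Arguments powAlg F n {d k} d_gt0 k_gt0.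

(* Main.v *)
(* With L = x + y + z, the squares x^2, y^2, z^2 = (x + y)^2 span, modulo L, all
   quadrics in x, y as soon as 2 is invertible. Hence, for I = (x^2, y^2, z^2),
   the ideal I^k + (L) contains every form of degree at least 2k, so that L is
   surjective onto those degrees; below degree 2k the algebra coincides with
   the polynomial ring, which is a domain. *)
Require Import Defs.
From mathcomp Require Import all_boot all_order all_algebra.
From mathcomp Require Import reals complex.
From mathcomp Require Import mpoly ring.

Set Implicit Arguments.
Unset Strict Implicit.
Unset Printing Implicit Defensive.

Import GRing.Theory Num.Theory.
Local Open Scope ring_scope.

Section Order.
Variables (F : fieldType) (n : nat).
Implicit Types (p q : {mpoly F[n]}) (I : {mpoly F[n]} -> Prop).

(** Membership in the [d]-th power of the ideal generated by the variables; 0 satisfies it for every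
    [d]. *)
Definition order_ge (d : nat) p := forall m : 'X_{1..n}, (mdeg m < d)%N -> p@_m = 0.

Lemma order_geM d e p q : order_ge d p -> order_ge e q -> order_ge (d + e) (p * q).
Proof.
move=> op oq m lt_m; rewrite mcoeffM big1 // => -[m1 m2] /= /eqP def_m.
have [lt_d | le_d] := ltnP (mdeg m1) d; first by rewrite op ?mul0r.
rewrite (oq m2) ?mulr0 // -(ltn_add2l d); apply: leq_ltn_trans lt_m.
by have := leq_add2r (mdeg m2) d (mdeg m1); rewrite le_d -mdegD -def_m.
Qed.

Lemma order_ge_gen d (S : {mpoly F[n]} -> Prop) :
  (forall g, S g -> order_ge d g) -> forall p, ideal_gen S p -> order_ge d p.
Proof.
move=> oS; apply: ideal_gen_min => // [m _|a u v ou ov m lt_m].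
  exact: mcoeff0.
rewrite mcoeffD ov // addr0.
(* Any [a] has order at least 0, vacuously. *)
by apply: (@order_geM 0 d a u).
Qed.

Lemma order_ge_exp d I k : (forall p, I p -> order_ge d p) ->
  forall p, ideal_exp I k p -> order_ge (k * d) p.
Proof.
move=> oI; elim: k => [|k IHk] p //=.
apply: order_ge_gen => _ [a [b [Ia Ib ->]]].
by rewrite mulSn; apply: order_geM; [apply: oI | apply: IHk].
Qed.

(** For the injective range: no nonzero form of degree below [k * d] is killed in the quotient. *)
Lemma pow_ideal_order d k p : pow_ideal d k p -> order_ge (k * d) p.
Proof.
apply: order_ge_exp; apply: order_ge_gen => _ [i ->] m lt_m.
rewrite mpolyXn mcoeffX; case: eqP => // def_m.
by move: lt_m; rewrite -def_m mdegMn mdeg1 mul1n ltnn.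
Qed.

Lemma order_ge_homog d i p : (i < d)%N -> p \is i.-homog -> order_ge d p -> p = 0.
Proof.
move=> lt_id hp op; apply/mpolyP=> m; rewrite mcoeff0.
have [/eqP dm|ne] := boolP (mdeg m == i); first by rewrite op // dm.
exact: dhomog_nemf_coeff hp ne.
Qed.

Lemma pihomogMl d e p q : p \is d.-homog ->
  pihomog mdeg (d + e) (p * q) = p * pihomog mdeg e q.
Proof.
move=> hp; have homog_pq j : p * pihomog mdeg j q \is (d + j).-homog.
  by apply: dhomogM => //; apply: pihomogP.
(* The bound also exceeds [e], so that index [e] occurs in the sum even when [q] has degree below
   [e]. *)
pose N := maxn (msize q) e.+1.
have lt_e : (e < N)%N by rewrite leq_maxr.
rewrite {1}(@pihomog_partitionE _ _ mdeg N q) ?leq_maxl //.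
rewrite mulr_sumr raddf_sum (bigD1 (Ordinal lt_e)) //= pihomog_dE // big1 ?addr0 //.
by move=> j ne; apply: (pihomog_ne0 _ (homog_pq j)); rewrite eqn_add2l.
Qed.

End Order.

Lemma mdeg_gt0_split n (m : 'X_{1..n}) : (0 < mdeg m)%N ->
  exists i m', m = (U_(i) + m')%MM /\ mdeg m = (mdeg m').+1.
Proof.
rewrite lt0n mdeg_eq0 => nz.
have /existsP[i mi] : [exists i, m i != 0%N].
  apply: contraNT nz; rewrite negb_exists => /forallP h.
  by apply/eqP/mnmP=> i; rewrite mnm0E; apply/eqP; move: (h i); rewrite negbK.
have def_m : m = (U_(i) + (m - U_(i)))%MM.
  apply/mnmP=> j; rewrite mnmDE mnmBE mnm1E subnKC //.
  by case: eqP => // <-; rewrite lt0n.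
by exists i, (m - U_(i))%MM; split=> //; rewrite {1}def_m mdegD mdeg1.
Qed.

Section Surjectivity.
Variable F : fieldType.
Hypothesis two_neq0 : 2%:R != 0 :> F.

Local Notation S := {mpoly F[3]}.
Local Notation L := (\sum_(i < 3) 'X_i : S).

(** For an ideal [I], this is membership in I + (L). *)
Definition mod_sumX (I : S -> Prop) (p : S) := exists u q, I u /\ p = u + L * q.

Lemma quadric_mod_sumX (i j : 'I_3) :
  mod_sumX (ideal_gen (fun g => exists i : 'I_3, g = 'X_i ^+ 2)) ('X_i * 'X_j).
Proof.
have sq_in l : ideal_gen (fun g : S => exists i : 'I_3, g = 'X_i ^+ 2) ('X_l ^+ 2).
  by apply: ideal_gen_in; exists l.
have [<-|ne_ij] := eqVneq i j.
  by exists ('X_i ^+ 2), 0; rewrite mulr0 addr0.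
have [l def_L] : exists l : 'I_3, L = 'X_i + 'X_j + 'X_l.
  have card3 : #|~: [set i; j]| = 1%N.
    by rewrite cardsCs setCK cards2 ne_ij card_ord.
  have /cards1P[l def_l] : #|~: [set i; j]| == 1%N by rewrite card3.
  exists l; rewrite (bigD1 i) //= (bigD1 j) ?(eq_sym j) //= -addrA; congr (_ + (_ + _)).
  rewrite (big_pred1 l) // => h; have := in_set1 h l.
  by rewrite -def_l !inE negb_or /= => <-.
pose c : S := (2%:R^-1)%:MP.
have c2 : c * 2%:R = 1.
  by rewrite /c -(rmorph_nat (@mpolyC 3 F)) -mpolyCM mulVf // mpolyC1.
(* As L - x_l = x_i + x_j, squaring gives 2 x_i x_j = x_l^2 - x_i^2 - x_j^2 + L (L - 2 x_l); the
   witnesses are the two parts of this, halved by [c]. *)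
exists (c * 'X_l ^+ 2 + (- c * 'X_i ^+ 2 + - c * 'X_j ^+ 2)), (c * (L - 2%:R * 'X_l)).
split; first by do ?apply: ideal_genD; apply: ideal_genM.
by rewrite def_L -[LHS]mul1r -[X in X * _]c2; ring.
Qed.

Lemma mod_sumX_mull I a p : I 0 -> (forall a u v, I u -> I v -> I (a * u + v)) ->
  mod_sumX I p -> mod_sumX I (a * p).
Proof.
move=> I0 IP [u [q [Iu ->]]]; exists (a * u), (a * q).
by split; [rewrite -[a * u]addr0; apply: IP | ring].
Qed.

(** Each factor of the power absorbs two variables of the monomial: their product lies in I + (L),
    and the remaining monomial in I^k + (L) by induction. *)
Lemma monomial_mod_sumX k (m : 'X_{1..3}) :
  (k * 2 <= mdeg m)%N -> mod_sumX (@pow_ideal F 3 2 k) 'X_[m].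
Proof.
elim: k m => [|k IHk] m le_m.
  by exists 'X_[m], 0; rewrite mulr0 addr0.
have [|i [m1 [def_m dm]]] := @mdeg_gt0_split _ m; first exact: leq_trans le_m.
have [|j [m2 [def_m1 dm1]]] := @mdeg_gt0_split _ m1.
  by rewrite -ltnS -dm; apply: leq_trans le_m.
have [|v [r [Iv def_v]]] := IHk m2.
  by move: le_m; rewrite dm dm1 mulSn.
have [u [q [Iu def_u]]] := quadric_mod_sumX i j.
(* Expansion of (u + L q)(v + L r), with the multiples of [L] collected. *)
exists (u * v), (q * (v + L * r) + u * r); split.
  by apply: ideal_gen_in; exists u, v.
by rewrite def_m def_m1 !mpolyXD mulrA def_u def_v; ring.
Qed.

Lemma homog_mod_sumX k d (p : S) : (k * 2 <= d)%N -> p \is d.-homog ->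
  mod_sumX (@pow_ideal F 3 2 k) p.
Proof.
move=> le_d hp; rewrite [p]mpolyE big_seq.
apply: (big_ind (mod_sumX _)).
- by exists 0, 0; rewrite mulr0 addr0; split=> //; apply: pow_ideal_0.
- move=> _ _ [u [q [Iu ->]]] [v [r [Iv ->]]]; exists (u + v), (q + r).
  by split; [rewrite -[u]mul1r; apply: pow_ideal_P | ring].
move=> m m_in; rewrite -mul_mpolyC; apply: mod_sumX_mull.
- exact: pow_ideal_0.
- exact: pow_ideal_P.
by apply: monomial_mod_sumX; rewrite (elimT (dhomogP _ _ _) hp m m_in).
Qed.

End Surjectivity.

Lemma sumX_homog (F : fieldType) n : (\sum_(i < n) 'X_i : {mpoly F[n]}) \is 1.-homog.
Proof. by apply: rpred_sum => i _; rewrite dhomogX; apply/eqP; exact: mdeg1. Qed.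

Lemma sumX_neq0 (F : fieldType) n : \sum_(i < n.+1) 'X_i != 0 :> {mpoly F[n.+1]}.
Proof.
(* The coefficient at the first variable is 1. *)
apply/eqP=> /(congr1 (mcoeff U_(ord0))) /eqP.
rewrite mcoeff0 raddf_sum (bigD1 ord0) //= mcoeffX eqxx big1 ?addr0 ?oner_eq0 //.
move=> i ne; rewrite mcoeffX; case: eqP => // e.
by move: (congr1 (fun m : 'X_{1..n.+1} => m i) e) ne; rewrite !mnm1E eqxx eq_sym; case: eqP.
Qed.

Theorem powAlg_3_2_WLP (F : fieldType) (k : nat) (hk : (0 < k)%N) :
  2%:R != 0 :> F -> WLP (powAlg F 3 (isT : (0 < 2)%N) hk).
Proof.
move=> two_neq0; set J := pow_homogIdeal F 3 (isT : (0 < 2)%N) hk.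
pose L : {mpoly F[3]} := \sum_(i < 3) 'X_i.
exists (hpi J L); split; first by exists L; split=> //; apply: sumX_homog.
(* The target degree [i.+1] decides, since relations start in degree 2k. *)
move=> i; have [lt_i | le_i] := ltnP i.+1 (k * 2); [left | right].
  move=> _ _ [p [hp ->]] [q [hq ->]]; rewrite -!hpiM => e.
  (* This form lies in [J] but has degree below 2k, so it vanishes as a polynomial. *)
  suff /eqP : L * (p - q) = 0.
    by rewrite mulf_eq0 (negbTE (sumX_neq0 _ _)) subr_eq0 => /eqP->.
  apply: (order_ge_homog lt_i).
    by apply: (dhomogM (sumX_homog _ _)); apply: rpredB.
  apply: pow_ideal_order; apply/(hpi_eq0 J).
  by rewrite mulrBr hpiD e -hpiD subrr hpi0.
move=> _ [p [hp ->]]; have [u [q [Ju def_p]]] := homog_mod_sumX two_neq0 le_i hp.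
(* [q] may be inhomogeneous: the degree [i.+1] component of p = u + L q involves only the degree [i]
   part of [q], and that component of [u] stays in the homogeneous ideal [J]. *)
exists (hpi J (pihomog mdeg i q)); split.
  by exists (pihomog mdeg i q); split=> //; apply: pihomogP.
rewrite -(pihomog_dE hp) def_p pihomogD hpiD -hpiM -[i.+1]add1n.
rewrite (pihomogMl _ _ (sumX_homog _ _)).
by have /(hpi_eq0 J) -> := hi_homog (h := J) (1 + i) Ju; rewrite add0r.
Qed.

(** [R[i]] is the complex field over a model [R] of the reals; 2 is nonzero there by characteristic
    zero. *)
Theorem theorem17 (R : realType) (k : nat) (hk : (1 <= k)%N) :
  WLP (powAlg R[i] 3 (isT : (0 < 2)%N) hk).
Proof. by apply: powAlg_3_2_WLP; rewrite pnatr_eq0. Qed.
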